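(* Let $\mathsf{SumToInfinity} = \{w_0w_1\ldots \in \mathbb{Z}^\omega \mid \lim_{k\to\infty}\sum_{i=0}^{k-1} w_i = +\infty\}$. Then $\mathsf{SumToInfinity}$ is $\boldsymbol{\Pi}^0_3$-complete and positional.
   Context: $\mathbb{Z}^\omega$ carries the product topology of discrete copies of $\mathbb{Z}$ (open sets are those of the form $L\mathbb{Z}^\omega$ for $L\subseteq \mathbb{Z}^*$ a set of finite words), and $\boldsymbol{\Pi}^0_3$ refers to the corresponding level of the Borel hierarchy; completeness is with respect to continuous (Wadge) reductions from subsets of $A^\omega$ for countable alphabets $A$. Games: an arena is a directed graph (of arbitrary cardinality) whose edges are labelled by integers, whose vertices are partitioned between two players, Eve and Adam, and in which every vertex has at least one outgoing edge. A play moves a token along edges, the owner of the current vertex choosing the outgoing edge, producing an infinite path whose sequence of labels is a word in $\mathbb{Z}^\omega$; Eve wins the play if this word belongs to the objective $W\subseteq\mathbb{Z}^\omega$. A strategy for Eve is positional if its choice depends only on the current vertex. An objective $W$ is positional if for every arena, Eve has a positional strategy that is winning from every vertex from which she has some winning strategy. *)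

(* Defs.v *)
From mathcomp Require Import all_boot all_order all_algebra.
From mathcomp Require Import all_classical topology normedtype.

Set Implicit Arguments.
Unset Strict Implicit.
Unset Printing Implicit Defensive.

Import Order.TTheory GRing.Theory Num.Theory.

Local Open Scope classical_set_scope.
Local Open Scope ring_scope.

(* The space of infinite words over A: product topology of discrete copies. *)
Notation word A := (prod_topology (fun _ : nat => discrete_topology A)).

(* The partial sums are cast to [rat] only because the filter of neighbourhoods
   of +oo is defined over fields. *)
Definition SumToInfinity : set (word int) :=
  [set w | (\sum_(0 <= i < k) (w i : int))%:~R @[k --> \oo] --> +oo_rat].

Section Borel_hierarchy.
Context {T : topologicalType}.

(* Finite levels of the Borel hierarchy, in the form valid for metrizable
   spaces (where the levels are increasing). Indices start at 1; level 0 is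
   a junk value. *)
Fixpoint Sigma0 (n : nat) : set (set T) :=
  match n with
  | 0 => set0
  | 1 => open
  | m.+1 => [set A | exists2 F : nat -> set T,
                       (forall i, Sigma0 m (~` F i)) & A = \bigcup_i F i]
  end.

Definition Pi0 (n : nat) : set (set T) := [set A | Sigma0 n (~` A)].

End Borel_hierarchy.

Definition Wadge_reducible (A B : choiceType)
    (L : set (word A)) (W : set (word B)) : Prop :=
  exists2 f : word A -> word B, continuous f & L = f @^-1` W.

Definition Pi0_complete (n : nat) (B : choiceType) (W : set (word B)) : Prop :=
  Pi0 n W /\
  forall (A : countType) (L : set (word A)), Pi0 n L -> Wadge_reducible L W.

Inductive player := Eve | Adam.

(* [edge v c v'] is an edge from v to v' with label c. *)
Record arena := Arena {
  vertex : Type;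
  edge : vertex -> int -> vertex -> Prop;
  owner : vertex -> player;
  edge_total : forall v, exists c v', edge v c v' }.

Section Strategies.
Variable G : arena.

(* A finite path: its initial vertex, and the successive labels and targets. *)
Definition history : Type := (vertex G * seq (int * vertex G))%type.

Definition current (h : history) : vertex G := last h.1 (unzip2 h.2).

(* A strategy for Eve; its values at Adam's vertices, and on sequences that
   are not paths of the arena, are irrelevant. *)
Record strategy := Strategy {
  move :> history -> int * vertex G;
  move_edge : forall h, owner (current h) = Eve ->
    edge (current h) (move h).1 (move h).2 }.

Definition is_play (p : nat -> vertex G) (w : word int) : Prop :=
  forall k, edge (p k) (w k) (p k.+1).

Definition prefix_play (p : nat -> vertex G) (w : word int) (k : nat) : history :=
  (p 0%N, mkseq (fun i => (w i : int, p i.+1)) k).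

Definition consistent (s : strategy) (p : nat -> vertex G) (w : word int) : Prop :=
  forall k, owner (p k) = Eve -> s (prefix_play p w k) = (w k, p k.+1).

Definition winning_from (W : set (word int)) (s : strategy) (v : vertex G) : Prop :=
  forall p w, p 0%N = v -> is_play p w -> consistent s p w -> W w.

Definition positional_strategy (s : strategy) : Prop :=
  forall h h', owner (current h) = Eve -> current h = current h' -> s h = s h'.

End Strategies.

Definition positional (W : set (word int)) : Prop :=
  forall G : arena, exists2 s : strategy G, positional_strategy s &
    forall v, (exists t : strategy G, winning_from W t v) -> winning_from W s v.

(* Main.v *)
(** Positionality. Let Eve play from winning positions according to arbitrary
winning strategies, and consider the graph of all histories so obtained: along
each of its infinite paths the sums tend to +oo. Hence the relation "a nonempty
path leads from x, with current sum s, to y with current sum s' <= 0" between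
pairs (x, s) is well-founded; let r(x, s) be its ordinal rank. Each history x
yields a nonincreasing sequence r(x, 0), r(x, 1), ... of ordinals. Nonincreasing
sequences of ordinals are well-ordered by the colexicographic order (compare at
the last difference), and Eve plays positionally by following, at each vertex, a
history whose sequence is least. Along the resulting plays, take a time whose
sequence is least among all later ones: the sum never returns to its value at
that time, because the first return would produce a smaller sequence. Iterating,
the sums tend to +oo.

Hardness. If L is the set of the words that, for each i, lie in some closed set
G i j, run for each i a pointer through j = 0, 1, ..., which advances when the
prefix read so far excludes G i j. Then w is in L iff each pointer advances
finitely often, iff the least index of a pointer advancing at time n tends to
+oo with n; this index is made the n-th partial sum. *)

Require Import Defs.
From mathcomp Require Import all_boot all_order all_algebra.
From mathcomp Require Import all_classical topology normedtype.
From mathcomp Require Import zify.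

Set Implicit Arguments.
Unset Strict Implicit.
Unset Printing Implicit Defensive.

Import Order.TTheory GRing.Theory Num.Theory.

Local Open Scope classical_set_scope.
Local Open Scope ring_scope.

(** * Divergence to infinity, stated over the integers *)

Definition diverges (S : nat -> int) : Prop :=
  forall N : int, exists K : nat, forall k, (K <= k)%N -> N <= S k.

Definition partial_sum (w : word int) (k : nat) : int :=
  \sum_(0 <= i < k) (w i : int).

Lemma SumToInfinityE (w : word int) :
  SumToInfinity w <-> diverges (partial_sum w).
Proof.
rewrite /SumToInfinity /=; split=> [/cvgryPge cvS N | divS].
  have [K _ SK] := cvS N%:~R; exists K => k Kk.
  by have := SK k Kk; rewrite /= ler_int.
apply/cvgryPge => A.
have [K SK] := divS (Num.ceil A); exists K => // k /= /SK AS.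
by apply: le_trans (ceil_ge A) _; rewrite ler_int.
Qed.

(** * The topology of words through finite prefixes *)

Section Words.
Variable A : choiceType.

Definition agree (n : nat) (w w' : word A) : Prop :=
  forall i, (i < n)%N -> w i = w' i.

Lemma agree_nbhs (w : word A) (n : nat) : nbhs w (agree n w).
Proof.
elim: n => [|n IHn]; first by apply: filterS filterT.
have wn : nbhs w [set w' : word A | w' n = w n].
  have wn1 : nbhs (w n : discrete_topology A) [set w n].
    by rewrite nbhs_principalE; apply/principal_filterP.
  exact: (@proj_continuous nat (fun=> discrete_topology A) n w _ wn1).
apply: filterS2 IHn wn => w' ww' w'n i; rewrite ltnS leq_eqVlt => /predU1P[->|].
  by rewrite w'n.
exact: ww'.
Qed.

Lemma agree_cvg (w : word A) (u : nat -> word A) :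
  (forall n, agree n w (u n)) -> u @ \oo --> w.
Proof.
move=> wu; apply/cvg_sup => i; rewrite /=.
move=> V [_ [[U _ <-] Uw] UV]; exists i.+1 => // n /= /wu wui.
by apply: UV; rewrite /= -wui.
Qed.

(** If no prefix of [w] suffices, choosing a counterexample for each length gives a sequence outside
    [U] converging to [w]. *)
Lemma open_agreeP (U : set (word A)) :
  open U <-> forall w, U w -> exists n, agree n w `<=` U.
Proof.
split=> [oU w Uw|agU]; last first.
  rewrite openE => w /agU[n nU]; exact: filterS nU (agree_nbhs w n).
apply: contrapT => /forallNP nU.
have /choice[u uP] n : exists w' : word A, agree n w w' /\ ~ U w'.
  by have /existsNP[w' /not_implyP] := nU n; exists w'.
have := @agree_cvg w u (fun n => (uP n).1) U (open_nbhs_nbhs (conj oU Uw)).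
by case=> n _ /(_ n (leqnn n)) /(uP n).2.
Qed.

End Words.

Lemma continuous_agree (A B : choiceType) (f : word A -> word B) :
  (forall n w w', agree n w w' -> agree n (f w) (f w')) -> continuous f.
Proof.
move=> fL; apply/continuousP => U /open_agreeP oU.
apply/open_agreeP => w /oU[n nU]; exists n => w' /fL; exact: nU.
Qed.

(** * Upper bound in the Borel hierarchy *)

Lemma agree_partial_sum n (w w' : word int) :
  agree n w w' -> partial_sum w n = partial_sum w' n.
Proof. by move=> ww'; apply: eq_big_nat => i /andP[_ /ww' ->]. Qed.

(** The complement is the union over [N] of the sets of words whose sums are below [N] infinitely
    often. Staying at least [N] from time [K] on is a closed condition, as each sum depends on a
    finite prefix. *)
Lemma Pi0_SumToInfinity : Pi0 3 SumToInfinity.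
Proof.
exists (fun N : nat =>
    [set w | forall K : nat, exists2 k, (K <= k)%N & partial_sum w k < N%:Z]).
  move=> N; exists (fun K : nat =>
      [set w | forall k, (K <= k)%N -> N%:Z <= partial_sum w k]) => [K /=|].
    apply/open_agreeP => w /existsNP[k /not_implyP[Kk /negP SN]].
    exists k => w' /agree_partial_sum ww' /(_ k Kk); rewrite -ww'.
    by move/negP: SN.
  rewrite seteqP; split=> w /= => [/existsNP[K SK]|[K _ SK] /(_ K)[k /SK]].
    by exists K => // k Kk; rewrite leNgt; apply/negP => Sk; apply: SK; exists k.
  by rewrite leNgt => /negP.
rewrite seteqP; split=> w /=.
  move=> nW; apply: contrapT => nN; apply/nW/SumToInfinityE => N.
  apply: contrapT => nK; apply: nN; exists `|N|%N => // K.
  apply: contrapT => nk; apply: nK; exists K => k Kk.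
  apply: (@le_trans _ _ `|N|%N%:Z); first by lia.
  by rewrite leNgt; apply/negP => ?; apply: nk; exists k.
move=> [N _ SN] /SumToInfinityE /(_ N)[K SK].
by have [k /SK] := SN K; rewrite leNgt => /negP.
Qed.

(** * Hardness: the pointer reduction *)

Section Hardness.
Variables (A : choiceType) (G : nat -> nat -> set (word A)).

Definition alive (i j n : nat) (w : word A) : bool :=
  `[< exists2 w', agree n w w' & G i j w' >].

Fixpoint pointer (i : nat) (w : word A) (n : nat) : nat :=
  if n is m.+1 then (pointer i w m + ~~ alive i (pointer i w m) m w)%N else 0%N.

Definition advance (i : nat) (w : word A) (n : nat) : bool :=
  ~~ alive i (pointer i w n) n w.

(** Only pointers below [n] are inspected; when none advances, [find] returns [n], which itself
    tends to infinity. The value at time 0 is 0, so the differences in [reduction] telescope without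
    a constant. *)
Definition least_advance (w : word A) (n : nat) : nat :=
  find (fun i => advance i w n) (iota 0 n).

Definition reduction (w : word A) : word int :=
  fun n => (least_advance w n.+1)%:Z - (least_advance w n)%:Z.

Lemma agreeS n (w w' : word A) : agree n.+1 w w' -> agree n w w'.
Proof. by move=> ww' i /ltnW; apply: ww'. Qed.

Lemma agree_alive i j n w w' : agree n w w' -> alive i j n w = alive i j n w'.
Proof.
move=> ww'; apply/asboolP/asboolP => -[v wv Gv]; exists v => // k kn.
  by rewrite -ww' ?wv.
by rewrite ww' ?wv.
Qed.

Lemma agree_pointer i n w w' :
  agree n w w' -> pointer i w n = pointer i w' n.
Proof.
elim: n => //= n IHn /agreeS ww'.
by rewrite (IHn ww') (agree_alive _ _ ww').
Qed.

Lemma agree_least_advance n w w' :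
  agree n w w' -> least_advance w n = least_advance w' n.
Proof.
move=> ww'; apply: eq_find => i.
by rewrite /advance (agree_pointer _ ww') (agree_alive _ _ ww').
Qed.

Lemma continuous_reduction : continuous reduction.
Proof.
apply: continuous_agree => n w w' ww' i ltin.
have wwi : agree i.+1 w w' by move=> k ki; apply: ww'; apply: leq_trans ki ltin.
by rewrite /reduction (agree_least_advance wwi) (agree_least_advance (agreeS wwi)).
Qed.

Lemma partial_sum_reduction w n :
  partial_sum (reduction w) n = (least_advance w n)%:Z.
Proof.
by rewrite /partial_sum telescope_sumr // subr0.
Qed.

Lemma leq_pointer i w m n : (m <= n)%N -> (pointer i w m <= pointer i w n)%N.
Proof.
elim: n => [|n IHn]; first by rewrite leqn0 => /eqP->.
rewrite leq_eqVlt => /predU1P[-> //|/IHn mn].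
by apply: leq_trans mn _; rewrite leq_addr.
Qed.

Lemma diverges_least_advance w :
  diverges (fun n => (least_advance w n)%:Z) <->
  forall i, exists K, forall n, (K <= n)%N -> ~~ advance i w n.
Proof.
split=> [divS i|stab].
  (* From time [i.+1] on, [i] is among the inspected indices. *)
  have [K SK] := divS i.+1%:Z; exists (maxn K i.+1) => n.
  rewrite geq_max => /andP[/SK Kn ltin]; apply/negP => adv.
  have /(before_find 0%N) : (i < least_advance w n)%N by lia.
  by rewrite nth_iota ?add0n ?adv.
suff stabN N : exists K, forall n, (K <= n)%N -> forall i, (i < N)%N -> ~~ advance i w n.
  move=> N; have [K stabK] := stabN `|N|%N.
  exists (maxn K `|N|%N) => n; rewrite geq_max => /andP[/stabK nadv Nn].
  apply: (@le_trans _ _ `|N|%N%:Z); first by lia.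
  rewrite lez_nat leqNgt; apply/negP => ltfN.
  have ltfn : (least_advance w n < n)%N := leq_trans ltfN Nn.
  have : has (fun i => advance i w n) (iota 0 n) by rewrite has_find size_iota.
  move=> /(nth_find 0%N); rewrite nth_iota //; apply/negP; exact: nadv.
elim: N => [|N [K1 IH]]; first by exists 0%N.
have [K2 stab2] := stab N.
exists (maxn K1 K2) => n; rewrite geq_max => /andP[/IH n1 /stab2 n2] i.
by rewrite ltnS leq_eqVlt => /predU1P[->|/n1].
Qed.

Hypothesis closedG : forall i j, open (~` G i j).

(** If the pointer rests at [j], every prefix of [w] extends into the closed set [G i j], which thus
    contains [w]. Conversely, the pointer cannot pass a [j] with [w] in [G i j]. *)
Lemma stabilizesP i w :
  (exists K, forall n, (K <= n)%N -> ~~ advance i w n) <-> exists j, G i j w.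
Proof.
split=> [[K stab]|[j Gj]].
  have ptr n : (K <= n)%N -> pointer i w n = pointer i w K.
    elim: n => [|n IHn]; first by rewrite leqn0 => /eqP->.
    rewrite leq_eqVlt => /predU1P[-> //|Kn].
    by move/negbTE: (stab n Kn); rewrite /advance /= => ->; rewrite addn0 IHn.
  exists (pointer i w K); apply: contrapT => nG.
  have /open_agreeP/(_ w nG)[n nU] := closedG i (pointer i w K).
  have := stab (maxn K n) (leq_maxl _ _); rewrite negbK => /asboolP[w' ww'].
  rewrite ptr ?leq_maxl //; apply: nU => k kn.
  by apply: ww'; apply: leq_trans kn (leq_maxr _ _).
have aliveG n : alive i j n w by apply/asboolP; exists w.
have ptr_le n : (pointer i w n <= j)%N.
  elim: n => //= n; rewrite leq_eqVlt => /predU1P[->|lt].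
    by rewrite aliveG addn0.
  by apply: leq_trans lt; rewrite -addn1 leq_add2l leq_b1.
apply: contrapT => nstab.
suff /(_ j.+1)[n] m : exists n, (m <= pointer i w n)%N by rewrite ltnNge ptr_le.
elim: m => [|m [K mK]]; first by exists 0%N.
apply: contrapT => nm; apply: nstab; exists K => n Kn; apply/negP => adv.
apply: nm; exists n.+1; rewrite /= -/(advance i w n) adv addn1 ltnS.
exact: leq_trans mK (leq_pointer i w Kn).
Qed.

Lemma reductionP w :
  SumToInfinity (reduction w) <-> forall i, exists j, G i j w.
Proof.
rewrite SumToInfinityE;
have -> : partial_sum (reduction w) = fun n => (least_advance w n)%:Z.
  by apply/funext => n; exact: partial_sum_reduction.
rewrite diverges_least_advance; split=> H i; exact/stabilizesP.
Qed.

End Hardness.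

Lemma Pi0_3P (T : topologicalType) (L : set T) : Pi0 3 L ->
  exists2 G : nat -> nat -> set T, (forall i j, open (~` G i j)) &
    L = [set w | forall i, exists j, G i j w].
Proof.
move=> [F sF FE].
have /choice[G GP] i : exists G : nat -> set T,
    (forall j, open (~` G j)) /\ ~` F i = \bigcup_j G j.
  by have [G oG GE] := sF i; exists G.
exists G => [i|]; first exact: (GP i).1.
rewrite -[L]setCK FE setC_bigcup seteqP; split=> w /= Lw i.
  by have := Lw i I; rewrite (GP i).2 => -[j _]; exists j.
by move=> _; rewrite (GP i).2; have [j] := Lw i; exists j.
Qed.

Theorem Pi0_complete_SumToInfinity : Pi0_complete 3 SumToInfinity.
Proof.
split=> [|A L /Pi0_3P[G oG ->]]; first exact: Pi0_SumToInfinity.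
exists (reduction G); first exact: continuous_reduction.
by rewrite seteqP; split=> w /= /(reductionP oG).
Qed.

(** * Ordinals and ranks of well-founded relations *)

(* Tree ordinals; distinct trees may have the same rank, so [ole] is a total
   preorder only. *)
Inductive ord : Type := Sup (I : Type) (f : I -> ord).

Fixpoint ole (x y : ord) {struct x} : Prop :=
  let: Sup X f := x in
  forall i, let: Sup Y g := y in exists j, ole (f i) (g j).

Definition olt (x y : ord) : Prop := let: Sup Y g := y in exists j, ole x (g j).

Lemma ole_supP (I : Type) (f : I -> ord) y :
  ole (Sup f) y <-> forall i, olt (f i) y.
Proof. by case: y. Qed.

Lemma ole_refl x : ole x x.
Proof. by elim: x => I f IH /= i; exists i. Qed.

Lemma ole_trans y x z : ole x y -> ole y z -> ole x z.
Proof.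
elim: x y z => I f IH [J g] [K h] xy yz /= i.
by have [j /IH xj] := xy i; have [k /xj] := yz j; exists k.
Qed.

Lemma ole_olt_trans y x z : ole x y -> olt y z -> olt x z.
Proof. by case: z => K h xy [k /(ole_trans xy)]; exists k. Qed.

Lemma olt_ole_trans y x z : olt x y -> ole y z -> olt x z.
Proof.
by case: y z => [J g] [K h] [j xj] /(_ j)[k /(ole_trans xj)]; exists k.
Qed.

Lemma oltNge x y : ~ ole x y -> olt y x.
Proof.
elim: x y => I f IH y /ole_supP/existsNP[i nlt]; exists i.
case: y nlt => J g nlt; apply/ole_supP => j.
by apply: IH => fg; apply: nlt; exists j.
Qed.

Lemma olt_wf : well_founded olt.
Proof.
(* Quantifying over all [y] below [x] makes structural induction on [x] go through. *)
suff acc x y : ole y x -> Acc olt y by move=> x; exact: acc (ole_refl x).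
elim: x y => I f IH [J g] yx; constructor => z [j zg].
by have [i /(ole_trans zg)] := yx j; exact: IH.
Qed.

Lemma olt_irr x : ~ olt x x.
Proof. by elim/(well_founded_ind olt_wf): x => x IH lt_xx; exact: (IH _ lt_xx). Qed.

Lemma oltW x y : olt x y -> ole x y.
Proof.
elim: y x => J g IH [X f] [j fj]; apply/ole_supP => i; exists j; apply: IH.
by move: fj => /ole_supP.
Qed.

Lemma ex_ole_min (T : Type) (F : T -> ord) (P : set T) :
  P !=set0 -> exists2 t, P t & forall u, P u -> ole (F t) (F u).
Proof.
move=> [t0]; move: {-2}(F t0) (erefl (F t0)) => x.
elim/(well_founded_ind olt_wf): x t0 => x IH t Ft Pt.
have [min|/existsNP[u /not_implyP[Pu /oltNge lt]]] :=
  pselect (forall u, P u -> ole (F t) (F u)); first by exists t.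
by apply: (IH (F u) _ u) => //; rewrite Ft.
Qed.

(** The rank is defined by recursion on accessibility proofs; [rankE] uses proof irrelevance to
    forget which proof was used. *)
Lemma wf_rank (T : Type) (R : T -> T -> Prop) : well_founded R ->
  exists rk : T -> ord, (forall x y, R y x -> olt (rk y) (rk x)) /\
    (forall x z, (forall y, R y x -> olt (rk y) z) -> ole (rk x) z).
Proof.
move=> wfR.
pose rank := fix rank x (a : Acc R x) {struct a} : ord :=
  Sup (fun y : {y | R y x} => rank (sval y) (Acc_inv a (svalP y))).
have rankE x (a : Acc R x) :
    rank x a = Sup (fun y : {y | R y x} => rank (sval y) (wfR (sval y))).
  case: a => a /=; congr Sup; apply/funext => -[y Ryx] /=.
  by congr (rank y _); exact: Prop_irrelevance.
exists (fun x => rank x (wfR x)); split=> [x y Ryx|x z Rz].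
  by rewrite (rankE x); exists (exist _ y Ryx); exact: ole_refl.
by rewrite rankE; apply/ole_supP => -[y Ryx] /=; exact: Rz.
Qed.

(** * The colexicographic order on sequences of ordinals *)

Definition noninc (f : nat -> ord) : Prop := forall s, ole (f s.+1) (f s).

Definition colt (f g : nat -> ord) : Prop :=
  exists2 m, olt (f m) (g m) & forall j, (m < j)%N -> ole (f j) (g j).

(* Not the negation of [colt] on arbitrary sequences; see [ex_cole_min]. *)
Definition cole (f g : nat -> ord) : Prop :=
  colt f g \/ forall j, ole (f j) (g j).

Definition shift (a : nat) (f : nat -> ord) : nat -> ord := fun s => f (s + a)%N.

Lemma noninc_le f : noninc f -> forall m n, (m <= n)%N -> ole (f n) (f m).
Proof.
move=> fN m n /subnK <-; elim: (n - m)%N => [|k IHk]; first exact: ole_refl.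
by rewrite addSn; exact: ole_trans (fN _) IHk.
Qed.

Lemma colt_irr f : ~ colt f f.
Proof. by case=> m /olt_irr. Qed.

Lemma coltW f g : colt f g -> cole f g.
Proof. by left. Qed.

Lemma colt_cole_trans g f h : colt f g -> cole g h -> colt f h.
Proof.
move=> [m fgm fg] [[n ghn gh]|gh]; last first.
  exists m => [|j /fg fgj]; first exact: olt_ole_trans fgm (gh m).
  exact: ole_trans fgj (gh j).
have fgh j : (maxn m n < j)%N -> ole (f j) (h j).
  by rewrite gtn_max => /andP[/fg fgj /gh]; exact: ole_trans.
exists (maxn m n) => //.
have [ltmn|ltnm|eqmn] := ltngtP m n.
- exact: ole_olt_trans (fg _ ltmn) ghn.
- exact: olt_ole_trans fgm (gh _ ltnm).
- by apply: olt_ole_trans fgm (oltW _); rewrite eqmn.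
Qed.

Lemma cole_colt_trans g f h : cole f g -> colt g h -> colt f h.
Proof.
move=> [fg /coltW|fg [n ghn gh]]; first exact: colt_cole_trans.
exists n => [|j /gh]; first exact: ole_olt_trans (fg n) ghn.
exact: ole_trans.
Qed.

Lemma cole_trans g f h : cole f g -> cole g h -> cole f h.
Proof.
move=> [fg gh|fg]; first by left; exact: colt_cole_trans gh.
move=> [gh|gh]; first by left; apply: cole_colt_trans gh; right.
by right=> j; exact: ole_trans (gh j).
Qed.

Lemma cole_shift a f g : cole f g -> cole (shift a f) (shift a g).
Proof.
move=> [[m fgm fg]|fg]; last by right=> j; exact: fg.
have [am|ma] := leqP a m.
  left; exists (m - a)%N => [|j]; first by rewrite /shift subnK.
  by rewrite ltn_subLR // addnC => /fg.
by right=> j; apply: fg; apply: leq_trans ma _; rewrite leq_addl.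
Qed.

Lemma shift_noninc a f : noninc f -> cole (shift a f) f.
Proof. by move=> fN; right=> j; apply: noninc_le; rewrite // leq_addr. Qed.

(** A least value [F t n] over all [t] and [n] makes [t] minimal from position [n] on. Descending to
    position 0, each stage picks the least value at the new position among the candidates already
    minimal above it. *)
Lemma ex_cole_min (T : Type) (F : T -> nat -> ord) (P : set T) :
  (forall t, P t -> noninc (F t)) -> P !=set0 ->
  exists2 t, P t & forall u, P u -> cole (F t) (F u).
Proof.
move=> Fnoninc [t0 Pt0].
pose cole_above i f g := cole (shift i f) (shift i g).
have [[t n] /= Pt tmin] := @ex_ole_min (T * nat) (fun p => F p.1 p.2)
  [set p | P p.1] (ex_intro _ (t0, 0%N) Pt0).
have : exists2 t, P t & forall u, P u -> cole_above n (F t) (F u).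
  exists t => // u Pu; right=> j; apply: (@ole_trans (F t n)).
    by apply: (noninc_le (Fnoninc t Pt)); rewrite leq_addl.
  exact: (tmin (u, (j + n)%N)).
elim: n {t Pt tmin} => [[t Pt tmin]|n IHn [t Pt tmin]].
  exists t => // u /tmin; rewrite /cole_above.
  suff shift0 f : shift 0 f = f by rewrite !shift0.
  by apply/funext => j; rewrite /shift addn0.
apply: IHn.
have [u [Pu ut] umin] := @ex_ole_min _ (fun u => F u n)
  [set u | P u /\ cole_above n.+1 (F u) (F t)]
  (ex_intro _ t (conj Pt (or_intror (fun=> ole_refl _)))).
exists u => // v Pv; have := cole_trans ut (tmin v Pv).
move=> [[m uvm uv]|uv].
  left; exists m.+1 => [|[//|j] mj]; first by rewrite /shift addSnnS.
  by rewrite /shift addSnnS; exact: uv.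
have [[j jlt]|nlt] := pselect (exists j, olt (shift n.+1 (F u) j) (shift n.+1 (F v) j)).
  left; exists j.+1 => [|[//|k] _]; rewrite /shift addSnnS //; exact: uv.
(* Here [F v] is pointwise below [F u] from [n.+1] on, so [v] competed in the choice of [u]. *)
have vt : cole_above n.+1 (F v) (F t).
  apply: cole_trans ut; right=> j; apply: contrapT => /oltNge vu.
  by apply: nlt; exists j.
right=> -[|j]; last by rewrite /shift addSnnS; exact: uv.
exact: umin.
Qed.

(** * Divergence along paths of the monotone graph *)

(* Monotone graph on the sequences of ordinals: g, shifted by c, is below f
   wherever both are defined, and strictly so when c <= 0, i.e. when [b = 0] can
   occur. *)
Definition cedge (c : int) (f g : nat -> ord) : Prop :=
  forall a b : nat, b%:Z = a%:Z + c ->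
    cole (shift b g) (shift a f) /\ (b = 0%N -> colt (shift b g) (shift a f)).

Lemma cedge_mono c f f' g g' :
  cole f f' -> cole g' g -> cedge c f g -> cedge c f' g'.
Proof.
move=> ff' gg' fg a b /fg[le lt]; split=> [|/lt].
  exact: cole_trans (cole_shift b gg') (cole_trans le (cole_shift a ff')).
move=> /(cole_colt_trans (cole_shift b gg')) /colt_cole_trans; apply.
exact: cole_shift.
Qed.

Lemma cedge_diverges (f : nat -> nat -> ord) (w : word int) :
  (forall k, noninc (f k)) -> (forall k, cedge (w k) (f k) (f k.+1)) ->
  diverges (partial_sum w).
Proof.
move=> fN fE; have : forall k, partial_sum w k.+1 = partial_sum w k + w k.
  by move=> k; rewrite /partial_sum big_nat_recr.
move: (partial_sum w) => S SS.
(* Until the return, the sequence at time [i], shifted by the height [S i - S k], stays below [f k];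
   the returning edge makes the comparison strict. *)
have drop k j : (k < j)%N -> S j <= S k ->
    (forall i, (k <= i < j)%N -> S k <= S i) -> colt (f j) (f k).
  case: j => // j; rewrite ltnS => kj Sjk Sk.
  have above d : (k + d <= j)%N ->
      forall a : nat, a%:Z = S (k + d)%N - S k -> cole (shift a (f (k + d)%N)) (f k).
    elim: d => [|d IHd] kdj a.
      rewrite addn0 subrr => -[->].
      by right=> s; rewrite /shift addn0; exact: ole_refl.
    rewrite addnS => aE.
    have [b bE] : exists b : nat, b%:Z = S (k + d)%N - S k.
      by exists `|(S (k + d)%N - S k)%R|%N; have := Sk (k + d)%N; lia.
    apply: cole_trans (IHd _ b bE); last by rewrite (leq_trans _ kdj) // leq_add2l.
    by apply: (fE (k + d)%N b a _).1; rewrite aE bE SS; lia.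
  have [b bE] : exists b : nat, b%:Z = S j - S k.
    by exists `|(S j - S k)%R|%N; have := Sk j; lia.
  (* The return may overshoot by [e]; read from position [b + e], the last edge lands at position 0,
     where [cedge] is strict. *)
  have [e eE] : exists e : nat, e%:Z = S k - S j.+1.
    by exists `|(S k - S j.+1)%R|%N; lia.
  have lt0 : colt (shift 0 (f j.+1)) (shift e (shift b (f j))).
    have -> : shift e (shift b (f j)) = shift (b + e) (f j).
      by apply/funext => s; rewrite /shift addnAC addnA.
    by apply: (fE j (b + e)%N 0%N _).2 => //; rewrite PoszD bE eE SS; lia.
  have -> : f j.+1 = shift 0 (f j.+1) by apply/funext => s; rewrite /shift addn0.
  apply: colt_cole_trans lt0 _; apply: cole_trans (shift_noninc e (fN k)).
  apply: cole_shift; have := above (j - k)%N; rewrite subnKC //; exact.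
(* Take [f k] colexicographically least among times from [K] on; the first return to [S k] would
   contradict [drop]. *)
have record K : exists2 k, (K <= k)%N & forall j, (k < j)%N -> S k < S j.
  have [k Kk kmin] := ex_cole_min (fun k (_ : (K <= k)%N) => fN k)
    (ex_intro [set k | (K <= k)%N] K (leqnn K)).
  exists k => // j0 kj0; rewrite ltNge; apply/negP => Sj0.
  have [|j /andP[kj Sj] jmin] := @ex_minnP (fun j => (k < j)%N && (S j <= S k)).
    by exists j0; rewrite kj0.
  have /drop := kj => /(_ Sj) lt.
  apply: (@colt_irr (f k)); apply: cole_colt_trans (kmin j _) (lt _).
    exact: leq_trans Kk (ltnW kj).
  move=> i /andP[ki ij]; rewrite leNgt; apply/negP => Sik.
  have [eik|nik] := eqVneq i k; first by move: Sik; rewrite eik ltxx.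
  have := jmin i; rewrite (ltW Sik) andbT => /(_ _); lia.
have [k0 _ k0P] := record 0%N.
have climb n : exists K, forall k, (K <= k)%N -> S k0 + n%:Z <= S k.
  (* Each further record raises the eventual lower bound by at least one. *)
  elim: n => [|n [K IH]].
    by exists k0.+1 => k /k0P /ltW; rewrite addr0.
  have [k Kk kP] := record K; exists k.+1 => j /kP; have := IH k Kk; lia.
move=> N; have [K KP] := climb `|(N - S k0)%R|%N.
exists K => k /KP; lia.
Qed.

(** * Ranking a graph all of whose paths diverge *)

Section UniversalRank.
Variables (H : Type) (E : H -> int -> H -> Prop).
Hypothesis E_diverges : forall (x : nat -> H) (w : word int),
  (forall k, E (x k) (w k) (x k.+1)) -> diverges (partial_sum w).

Definition config_step (p q : H * int) : Prop := E p.1 (q.2 - p.2) q.1.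

Fixpoint walk (n : nat) (p q : H * int) : Prop :=
  if n is m.+1 then exists2 r, config_step p r & walk m r q else p = q.

Definition later_dip (q p : H * int) : Prop := q.2 <= 0 /\ exists n, walk n.+1 p q.

Lemma walk_shift (a : int) n p q :
  walk n p q -> walk n (p.1, p.2 + a) (q.1, q.2 + a).
Proof.
elim: n p => [|n IHn] p /=; first by move=> ->.
move=> [r pr /IHn rq]; exists (r.1, r.2 + a) => //.
by rewrite /config_step /= opprD addrACA subrr addr0.
Qed.

Lemma later_dip_wf : well_founded later_dip.
Proof.
have nAcc p : ~ Acc later_dip p -> exists q n,
    [/\ walk n.+1 p q, q.2 <= 0 & ~ Acc later_dip q].
  move=> np; apply: contrapT => nq; apply: np; constructor => q [q0 [n pq]].
  by apply: contrapT => aq; apply: nq; exists q, n.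
(* Chaining the walks of an infinite descending sequence into one path: the
   state records the length of the remaining walk to the next dip. *)
pose P (s : (H * int) * nat) := exists q,
  [/\ walk s.2 s.1 q, q.2 <= 0 & ~ Acc later_dip q].
pose next (s t : {s | P s}) := config_step (sval s).1 (sval t).1 /\
  ((sval s).2 = (sval t).2.+1 \/ (sval s).1.2 <= 0).
have nextP s : {t | next s t}.
  apply: cid; case: s => [[p [|n]] Ps]; have [q [/= pq q0 nq]] := Ps.
    move: q0 nq; rewrite -pq => p0 /nAcc[q' [n [[r pr rq'] q'0 nq']]].
    have Pr : P (r, n) by exists q'.
    by exists (exist P _ Pr); split => //=; right.
  have [r pr rq] := pq.
  have Pr : P (r, n) by exists q.
  by exists (exist P _ Pr); split => //=; left.
move=> p0; apply: contrapT => /nAcc[q0 [n0 p0q0]].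
have P0 : P (p0, n0.+1) by exists q0.
have [f [_ fnext]] := dependent_choice nextP (exist P _ P0).
pose x k := (sval (f k)).1.1; pose s k := (sval (f k)).1.2.
pose w : word int := fun k => s k.+1 - s k.
have dip n k : (sval (f k)).2 = n -> exists2 j, (k <= j)%N & s j <= 0.
  elim: n k => [|n IHn] k fk; have [_ [|sk]] := fnext k; try by exists k.
    by rewrite fk.
  by rewrite fk => -[/esym/IHn[j kj]]; exists j => //; apply: ltnW.
(* From time [K] on, [s] is at least 1, which excludes the dips given by [dip]. *)
have [K SK] := E_diverges (x := x) (w := w) (fun k => (fnext k).1) (1 - s 0%N).
have [j Kj sj] := dip _ K erefl.
have := SK j Kj; rewrite /partial_sum /w telescope_sumr //.
by rewrite lerD2r => /le_trans /(_ sj).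
Qed.

(** Lowering the starting sum keeps every dip a dip, so ranks do not increase with the sum. Along an
    edge, the dips after [y] are dips after [x]; if [b = 0], the configuration at [y] is itself a
    dip, whence strictness. *)
Lemma ex_universal_rank : exists2 phi : H -> nat -> ord,
  (forall x, noninc (phi x)) &
  (forall x c y, E x c y -> cedge c (phi x) (phi y)).
Proof.
have [rk [rk_lt rk_le]] := wf_rank later_dip_wf.
exists (fun x s => rk (x, s%:Z)) => [x s|x c y xy a b bE].
  have -> : s.+1%:Z = s%:Z + 1 by lia.
  suff rkS q : ole (rk (q.1, q.2 + 1)) (rk q) by exact: rkS (x, s%:Z).
  elim/(well_founded_ind later_dip_wf): q => q IH.
  apply: rk_le => r [r0 [n /(walk_shift (-1))/=]].
  rewrite addrK -surjective_pairing => qr.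
  have rq : later_dip (r.1, r.2 - 1) q by split; [rewrite /=; lia | exists n].
  have := IH _ rq; rewrite /= subrK -surjective_pairing => /ole_olt_trans.
  by apply; exact: rk_lt.
have step s : config_step (x, (s + a)%N%:Z) (y, (s + b)%N%:Z).
  by rewrite /config_step /= (_ : _ - _ = c) // !PoszD bE; lia.
have le s : ole (rk (y, (s + b)%N%:Z)) (rk (x, (s + a)%N%:Z)).
  apply: rk_le => q [q0 [n yq]]; apply: rk_lt; split => //.
  by exists n.+1; exists (y, (s + b)%N%:Z).
split=> [|b0]; first by right.
exists 0%N => [|j _]; last exact: le.
apply: rk_lt; split; first by rewrite b0.
by exists 0%N; exists (y, (0 + b)%N%:Z).
Qed.

End UniversalRank.

(** * From winning strategies to a positional one *)

Section Arena.
Variable G : arena.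

(** Winning strategies may differ between starting vertices, so each history carries the strategy
    being followed. *)
Definition node : Type := (strategy G * history G)%type.

Definition node_at (n : node) : vertex G := current n.2.

Definition continuation (h : history G) (p : nat -> vertex G) (w : word int)
    (k : nat) : history G :=
  (h.1, h.2 ++ mkseq (fun i => (w i : int, p i.+1)) k).

Definition node_wins (n : node) : Prop := forall p w,
  p 0%N = node_at n -> is_play p w ->
  (forall k, owner (p k) = Eve -> n.1 (continuation n.2 p w k) = (w k, p k.+1)) ->
  SumToInfinity w.

Definition node_step (n : node) (c : int) (n' : node) : Prop :=
  [/\ n' = (n.1, (n.2.1, rcons n.2.2 (c, node_at n'))),
      edge (node_at n) c (node_at n') &
      owner (node_at n) = Eve -> n.1 n.2 = (c, node_at n')].

Lemma partial_sum_tail (w w' : word int) k :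
  (forall i, w' i.+1 = w i) -> partial_sum w' k.+1 = w' 0%N + partial_sum w k.
Proof.
move=> ww'; rewrite /partial_sum big_nat_recl //; congr (_ + _).
by apply: eq_bigr => i _.
Qed.

Lemma SumToInfinity_tail (w w' : word int) :
  (forall i, w' i.+1 = w i) -> SumToInfinity w' -> SumToInfinity w.
Proof.
move=> ww' /SumToInfinityE divS; apply/SumToInfinityE => N.
have [K SK] := divS (w' 0%N + N); exists K => k Kk.
by have := SK k.+1 (leqW Kk); rewrite (partial_sum_tail _ ww') lerD2l.
Qed.

Lemma mkseqSl (T : Type) (f : nat -> T) k :
  mkseq f k.+1 = f 0%N :: mkseq (fun i => f i.+1) k.
Proof. by rewrite /mkseq /= (iotaDl 1 0) -map_comp. Qed.

Lemma node_at_rcons t h c (v : vertex G) : node_at (t, (h.1, rcons h.2 (c, v))) = v.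
Proof. by rewrite /node_at /current /= /unzip2 map_rcons last_rcons. Qed.

(** Prepending the step turns a play from [n'] into one from [n], and the objective passes to
    tails. *)
Lemma node_step_wins n c n' : node_step n c n' -> node_wins n -> node_wins n'.
Proof.
move=> [n'E nn' nEve] nwin p w p0 pw con.
pose p' k := if k is j.+1 then p j else node_at n.
pose w' : word int := fun k => if k is j.+1 then w j else c.
apply: (@SumToInfinity_tail w w') => //; apply: (nwin p' w') => // -[|k] //=.
- by rewrite p0.
- by move=> /nEve; rewrite /continuation cats0 -surjective_pairing p0.
move=> /con; rewrite {1}n'E /= => <-; congr (n.1 _).
by rewrite n'E /continuation /= mkseqSl /= cat_rcons p0.
Qed.

Definition live : Type := {n : node | node_wins n}.

Definition live_at (x : live) : vertex G := node_at (sval x).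

Definition live_step (x : live) (c : int) (y : live) : Prop :=
  node_step (sval x) c (sval y).

(** The nodes of a path extend one history under one strategy, so the path is a play consistent with
    the winning strategy of [x 0]. *)
Lemma live_step_diverges (x : nat -> live) (w : word int) :
  (forall k, live_step (x k) (w k) (x k.+1)) -> diverges (partial_sum w).
Proof.
move=> xw; apply/SumToInfinityE.
have xE k : sval (x k) =
    ((sval (x 0%N)).1, continuation (sval (x 0%N)).2 (live_at \o x) w k).
  elim: k => [|k IHk].
    by rewrite /continuation cats0 -!surjective_pairing.
  by have [-> _ _] := xw k; rewrite IHk /continuation mkseqS -rcons_cat.
apply: (svalP (x 0%N) (live_at \o x)) => // k; first by have [] := xw k.
by move=> Eve_k; have [_ _ /(_ Eve_k)] := xw k; rewrite {1 2}xE.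
Qed.

Lemma live_extend (x : live) (c : int) (v : vertex G) :
  edge (live_at x) c v ->
  (owner (live_at x) = Eve -> (sval x).1 (sval x).2 = (c, v)) ->
  exists2 y : live, live_at y = v & live_step x c y.
Proof.
case: x => [[t h] hwin]; rewrite /live_at /= => hv hEve.
pose n := (t, (h.1, rcons h.2 (c, v))).
have nv : node_at n = v by exact: node_at_rcons.
have hn : node_step (t, h) c n by split; rewrite ?nv.
by exists (exist _ n (node_step_wins hn hwin)).
Qed.

Lemma winning_live (t : strategy G) v :
  winning_from SumToInfinity t v -> exists x : live, live_at x = v.
Proof.
move=> tv; suff nwin : node_wins (t, (v, [::])) by exists (exist _ _ nwin).
by move=> p w p0 pw con; apply: (tv p w) => // k /con; rewrite /prefix_play p0.
Qed.

Lemma current_prefix_play (p : nat -> vertex G) w k :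
  current (prefix_play p w k) = p k.
Proof.
case: k => // k.
by rewrite /current /prefix_play /unzip2 mkseqS map_rcons last_rcons.
Qed.

Lemma ex_positional_winning : exists2 s : strategy G, positional_strategy s &
  forall v, (exists t, winning_from SumToInfinity t v) ->
    winning_from SumToInfinity s v.
Proof.
have [phi phiN phiE] := ex_universal_rank live_step_diverges.
(* [rho v] is the least rank sequence of the live nodes at [v], with a junk value if there are
   none. *)
have /choice[rho rhoP] v : exists f : nat -> ord,
    (exists x, live_at x = v) -> (exists2 x, live_at x = v & f = phi x) /\
      forall x, live_at x = v -> cole f (phi x).
  have [lv|nlv] := pselect (exists x, live_at x = v); last first.
    by exists (fun=> Sup (fun i : False => match i with end)) => /nlv.
  have [x xv xmin] := ex_cole_min (fun x (_ : live_at x = v) => phiN x) lv.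
  by exists (phi x); split=> //; exists x.
pose ranked_edge v c v' := (exists x, live_at x = v) ->
  (exists x, live_at x = v') /\ cedge c (rho v) (rho v').
(* The successor of a minimizing node is a live node at [v'], whose sequence bounds [rho v'] from
   above. *)
have step x c v' : rho (live_at x) = phi x -> edge (live_at x) c v' ->
    (owner (live_at x) = Eve -> (sval x).1 (sval x).2 = (c, v')) ->
    ranked_edge (live_at x) c v'.
  move=> rhox xv' xEve _; have [y yv' xy] := live_extend xv' xEve.
  have lv' : exists x, live_at x = v' by exists y.
  split=> //; have [_ /(_ y yv') rho_y] := rhoP v' lv'.
  apply: cedge_mono rho_y (phiE _ _ _ xy).
  by right=> j; rewrite rhox; exact: ole_refl.
have adam v c v' : owner v = Adam -> edge v c v' -> ranked_edge v c v'.
  move=> vAdam vv' lv; have [[x xv /esym rhox] _] := rhoP v lv.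
  by move: vAdam vv' lv rhox; rewrite -xv => vAdam vv' lv rhox;
    apply: (step x c v') lv; rewrite ?vAdam.
(* Play the move of a minimizing node; at vertices without live nodes, any edge. *)
have /choice[sigma sigmaP] v : exists cv : int * vertex G, owner v = Eve ->
    edge v cv.1 cv.2 /\ ranked_edge v cv.1 cv.2.
  have [c [v' vv']] := edge_total v.
  have [lv|nlv] := pselect (exists x, live_at x = v); last first.
    by exists (c, v') => _; split=> // /nlv.
  have [[x xv rhox] _] := rhoP v lv.
  exists ((sval x).1 (sval x).2); rewrite -xv => xEve.
  have xedge := @move_edge _ (sval x).1 _ xEve.
  split=> //; apply: step => //; first by rewrite xv.
  by rewrite -surjective_pairing.
have sigma_edge (h : history G) : owner (current h) = Eve ->
    edge (current h) (sigma (current h)).1 (sigma (current h)).2.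
  by move=> /sigmaP[].
exists (Strategy sigma_edge) => [h h' _ /= -> //|v [t /winning_live lv]].
move=> p w p0 pw con; apply/SumToInfinityE.
have ranked k : ranked_edge (p k) (w k) (p k.+1).
  case pk : (owner (p k)); last exact: adam.
  by have := con k pk; rewrite /= current_prefix_play => sk;
    have [_] := sigmaP _ pk; rewrite sk.
have livep k : exists x, live_at x = p k.
  by elim: k => [|k IHk]; [rewrite p0 | have [] := ranked k IHk].
apply: (@cedge_diverges (rho \o p)) => k /=.
  by have [[x _ ->] _] := rhoP _ (livep k); exact: phiN.
by have [_] := ranked k (livep k).
Qed.

End Arena.

Theorem theorem1 : Pi0_complete 3 SumToInfinity /\ positional SumToInfinity.
Proof.
split; first exact: Pi0_complete_SumToInfinity.
exact: ex_positional_winning.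
Qed.
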